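(* Having finite width (respectively, finite height) is a quasi-isometry invariant of group pairs: if $(G,\mathcal{P})$ and $(H,\mathcal{Q})$ are quasi-isometric group pairs, then $(G,\mathcal{P})$ has finite width (respectively, finite height) if and only if $(H,\mathcal{Q})$ has finite width (respectively, finite height).
   Context: A group pair $(G,\mathcal{P})$ is a finitely generated group $G$ together with a finite collection $\mathcal{P}$ of infinite subgroups of $G$. $G$ carries a fixed word metric with respect to a finite generating set and $\mathrm{hdist}_G$ is the corresponding Hausdorff distance between subsets. $G/\mathcal{P}$ is the set of all left cosets $gP$, $g\in G$, $P\in\mathcal{P}$. $(G,\mathcal{P})$ and $(H,\mathcal{Q})$ are quasi-isometric if there are a quasi-isometry $q\colon G\to H$ and $M>0$ such that for every $A\in G/\mathcal{P}$ there is $B\in H/\mathcal{Q}$ with $\mathrm{hdist}_H(q(A),B)<M$, and for every $B\in H/\mathcal{Q}$ there is $A\in G/\mathcal{P}$ with $\mathrm{hdist}_H(q(A),B)<M$. The height of $\mathcal{P}$ in $G$ is the maximal $m\in\mathbb{N}$ such that there are $m$ distinct cosets $g_1P_1,\dots,g_mP_m\in G/\mathcal{P}$ with $\bigcap_{i=1}^m g_iP_ig_i^{-1}$ infinite. The width of $\mathcal{P}$ in $G$ is the maximal $m\in\mathbb{N}$ such that there are $m$ distinct cosets $g_1P_1,\dots,g_mP_m\in G/\mathcal{P}$ with $g_iP_ig_i^{-1}\cap g_jP_jg_j^{-1}$ infinite for all $1\le i<j\le m$. The pair has finite height (width) if such $m$ are bounded. *)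

(* Defs.v *)
From HB Require Import structures.
From mathcomp Require Import all_boot all_order all_algebra.
From mathcomp Require Import boolp classical_sets cardinality reals.
From mathcomp Require Import constructive_ereal ereal.

Set Implicit Arguments.
Unset Strict Implicit.
Unset Printing Implicit Defensive.

Import Order.TTheory GRing.Theory Num.Theory.
Local Open Scope classical_set_scope.
Local Open Scope ring_scope.

Section Words.
Variable G : groupType.
Implicit Types (S : set G) (x y : G).

Definition word S (s : seq G) : Prop :=
  forall y, y \in s -> S y \/ S (y^-1)%g.

Definition spelled_by S x (n : nat) : Prop :=
  exists s : seq G, [/\ word S s, size s = n & (\prod_(y <- s) y)%g = x].

Definition generates S : Prop := forall x, exists n, spelled_by S x n.

(* The least length of a word spelling x. The default value 0 is only reached
   when x is not in the subgroup generated by S. *)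
Definition word_norm S x : nat :=
  xget 0%N [set n | spelled_by S x n /\
                    forall m, spelled_by S x m -> (n <= m)%N].

(* Left-invariant, so that left translations are isometries. *)
Definition word_dist (R : realType) S x y : R := (word_norm S (x^-1 * y)%g)%:R.

End Words.

Definition finite_generating_set (G : groupType) (S : set G) : Prop :=
  finite_set S /\ generates S.

Definition finitely_generated (G : groupType) : Prop :=
  exists S : set G, finite_generating_set S.

Section Distances.
Variable R : realType.

Definition quasi_isometry (X Y : Type) (dX : X -> X -> R) (dY : Y -> Y -> R)
    (q : X -> Y) : Prop :=
  exists L C : R, [/\ 1 <= L, 0 <= C,
    forall x x', L^-1 * dX x x' - C <= dY (q x) (q x') <= L * dX x x' + C &
    forall y, exists x, dY y (q x) <= C].

(* Extended-real valued: +oo when no neighbourhood of finite radius works. *)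
Definition hdist (X : Type) (d : X -> X -> R) (A B : set X) : \bar R :=
  ereal_inf [set r%:E | r in [set r : R | [/\ 0 <= r,
    forall a, A a -> exists2 b, B b & d a b <= r &
    forall b, B b -> exists2 a, A a & d a b <= r]]].

End Distances.

Section Pairs.
Variable G : groupType.
Implicit Types (P : set G) (PP : set (set G)).

Definition group_pair PP : Prop :=
  [/\ finitely_generated G, finite_set PP &
      forall P, PP P -> group_closed (mem P) /\ infinite_set P].

Definition left_coset (g : G) P : set G := [set (g * x)%g | x in P].

Definition conj_subgroup (g : G) P : set G := [set (g * x * g^-1)%g | x in P].

(* G / PP *)
Definition left_cosets PP : set (set G) :=
  [set A | exists g, exists2 P, PP P & A = left_coset g P].

(* The cosets g_i P_i are compared as subsets of G; the subset g P determines
   P, hence the conjugate g P g^-1. *)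
Definition distinct_cosets PP (m : nat) (g : 'I_m -> G) (P : 'I_m -> set G) :
    Prop :=
  (forall i, PP (P i)) /\ injective (fun i => left_coset (g i) (P i)).

Definition finite_height PP : Prop :=
  exists N : nat, forall m (g : 'I_m -> G) (P : 'I_m -> set G),
    distinct_cosets PP g P ->
    infinite_set (\bigcap_i conj_subgroup (g i) (P i)) -> (m <= N)%N.

Definition finite_width PP : Prop :=
  exists N : nat, forall m (g : 'I_m -> G) (P : 'I_m -> set G),
    distinct_cosets PP g P ->
    (forall i j : 'I_m, (i < j)%N ->
       infinite_set (conj_subgroup (g i) (P i) `&` conj_subgroup (g j) (P j))) ->
    (m <= N)%N.

End Pairs.

(* S and T are the finite generating sets fixing the word metrics. *)
Definition quasi_isometric_pairs (R : realType) (G H : groupType)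
    (S : set G) (T : set H) (PP : set (set G)) (QQ : set (set H)) : Prop :=
  exists (q : G -> H) (M : R),
    [/\ quasi_isometry (word_dist R S) (word_dist R T) q,
        0 < M,
        forall A, left_cosets PP A ->
          exists2 B, left_cosets QQ B &
            (hdist (word_dist R T) (q @` A) B < M%:E)%E &
        forall B, left_cosets QQ B ->
          exists2 A, left_cosets PP A &
            (hdist (word_dist R T) (q @` A) B < M%:E)%E].

(* Main.v *)
(** A finite family of conjugates g_i P_i g_i^-1 has infinite intersection if and
only if, for some r, the r-neighbourhoods of the cosets g_i P_i do: a group
element x of the conjugates is at distance |g_i| from x g_i, and conversely the
pigeonhole principle applies because balls are finite. The second condition is
preserved by quasi-isometries. Matching every coset of H with a coset of G is
not injective, but it is uniformly finite-to-one: cosets matched with the same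
A all meet one ball of fixed radius around a point corresponding to a point of
A, and such a ball meets boundedly many cosets. So if N bounds the height
(width) of G, then k N bounds that of H. *)

Require Import Defs.
From mathcomp Require Import all_boot all_order all_algebra.
From mathcomp Require Import boolp classical_sets cardinality reals.
From mathcomp Require Import constructive_ereal ereal.

Set Implicit Arguments.
Unset Strict Implicit.
Unset Printing Implicit Defensive.

Import Order.TTheory GRing.Theory Num.Theory.
Local Open Scope classical_set_scope.

(** * Word norms and finiteness of balls *)

Section WordNorm.
Variables (G : groupType) (S : set G).
Hypothesis genS : generates S.

(** Generation makes the set of lengths nonempty, so the default value 0 is never taken. *)
Lemma word_normP x : spelled_by S x (word_norm S x) /\
  forall n, spelled_by S x n -> (word_norm S x <= n)%N.
Proof.
rewrite /word_norm.
apply: (@xgetPex _ 0%N [set n | spelled_by S x n /\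
  forall m, spelled_by S x m -> (n <= m)%N]).
have ex : exists n, `[< spelled_by S x n >].
  by have [n xn] := genS x; exists n; apply/asboolP.
case: (ex_minnP ex) => n /asboolP xn minn; exists n; split=> // m xm.
by apply: minn; apply/asboolP.
Qed.

Lemma word_norm1 : word_norm S 1%g = 0%N.
Proof.
apply/eqP; rewrite -leqn0; apply: (word_normP _).2.
by exists [::]; split=> //; rewrite big_nil.
Qed.

Lemma word_normV_le x : (word_norm S x^-1%g <= word_norm S x)%N.
Proof.
apply: (word_normP _).2; have [[s [ws ss sx]] _] := word_normP x.
exists (rev (map (fun y => y^-1%g) s)); split.
- move=> y; rewrite mem_rev => /mapP[z /ws zS ->].
  by rewrite invgK; case: zS; [right|left].
- by rewrite size_rev size_map.
- by rewrite -map_rev big_map prodgV revK sx.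
Qed.

Lemma word_normV x : word_norm S x^-1%g = word_norm S x.
Proof.
apply/eqP; rewrite eqn_leq word_normV_le /=.
by rewrite -{1}[x]invgK word_normV_le.
Qed.

Lemma word_normM x y :
  (word_norm S (x * y)%g <= word_norm S x + word_norm S y)%N.
Proof.
apply: (word_normP _).2; have [[s [ws ss sx]] _] := word_normP x.
have [[t [wt st tx]] _] := word_normP y.
exists (s ++ t); split; last by rewrite big_cat /= sx tx.
  by move=> z; rewrite mem_cat => /orP[/ws|/wt].
by rewrite size_cat ss st.
Qed.

Lemma word_norm_triangle y x z :
  (word_norm S (x^-1 * z)%g
   <= word_norm S (x^-1 * y)%g + word_norm S (y^-1 * z)%g)%N.
Proof. by have := word_normM (x^-1 * y) (y^-1 * z); rewrite mulgA mulgK. Qed.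

Lemma word_norm_sym x y : word_norm S (x^-1 * y)%g = word_norm S (y^-1 * x)%g.
Proof. by rewrite -word_normV invgM invgK. Qed.

Lemma finite_spelled n : finite_set S -> finite_set [set x | spelled_by S x n].
Proof.
move=> finS; elim: n => [|n IHn].
  apply: (@sub_finite_set _ _ [set 1%g]) => // x [s [_ /size0nil -> <-]].
  by rewrite big_nil.
apply: (@sub_finite_set _ _ [set (p.1 * p.2)%g | p in
   (S `|` [set y^-1%g | y in S]) `*` [set x | spelled_by S x n]]).
  move=> x [[|y s] [ws // [ss] <-]]; exists (y, (\prod_(z <- s) z)%g) => /=.
    split=> /=; last first.
      by exists s; split=> // z zs; apply: ws; rewrite inE zs orbT.
    have [|yS|yS] := ws y; rewrite ?mem_head //; first by left.
    by right; exists y^-1%g; rewrite ?invgK.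
  by rewrite big_cons.
apply: finite_image; apply: finite_setX => //.
by rewrite finite_setU; split=> //; apply: finite_image.
Qed.

Lemma finite_ball n :
  finite_set S -> finite_set [set x | (word_norm S x <= n)%N].
Proof.
move=> finS; apply: (@sub_finite_set _ _
  (\bigcup_(m in `I_n.+1) [set x | spelled_by S x m])).
  by move=> x /= xn; exists (word_norm S x) => //; have [] := word_normP x.
by apply: bigcup_finite => // m _; apply: finite_spelled.
Qed.

Definition thickening (A : set G) (r : nat) : set G :=
  [set x | exists2 a, A a & (word_norm S (a^-1 * x)%g <= r)%N].

End WordNorm.

(** * Conjugates versus neighbourhoods of cosets *)

Section Cosets.
Variable G : groupType.

Lemma left_coset_refl (g : G) P :
  group_closed (mem P) -> left_coset g P g.
Proof. by case=> /set_mem P1 _; exists 1%g => //; rewrite mulg1. Qed.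

Lemma left_coset_eq (g x : G) P :
  group_closed (mem P) -> left_coset g P x -> left_coset g P = left_coset x P.
Proof.
move=> gP [p Pp <-]; have [PV PM] := (group_closedV gP, group_closedM gP).
apply/seteqP; split=> _ [u Pu <-].
  exists (p^-1 * u)%g; last by rewrite -mulgA mulVKg.
  by apply/set_mem/PM; [apply: PV|]; apply/mem_set.
by exists (p * u)%g; rewrite ?mulgA //; apply/set_mem/PM; apply/mem_set.
Qed.

Variables (S : set G) (I : finType) (g : I -> G) (P : I -> set G) (D : set I).
Hypotheses (finS : finite_set S) (genS : generates S).
Hypothesis gP : forall i, group_closed (mem (P i)).

(** The subset [D] lets one argument serve both notions: all indices for height, a pair of indices
    for width. *)
Let K := \bigcap_(i in D) conj_subgroup (g i) (P i).

Lemma conj_sub_thickening :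
  exists r, K `<=` \bigcap_(i in D) thickening S (left_coset (g i) (P i)) r.
Proof.
exists (\max_i word_norm S (g i)) => x Kx i Di; have [p Pp <-] := Kx i Di.
exists (g i * p)%g; first by exists p.
by rewrite mulKg word_normV // (leq_bigmax (F := fun i => word_norm S (g i))).
Qed.

(* Record, for each point of the intersection, the displacements that carry it
   into the cosets: points with equal displacements differ by an element of K,
   and there are finitely many displacements. *)
Lemma infinite_thickening_conj r :
  infinite_set (\bigcap_(i in D) thickening S (left_coset (g i) (P i)) r) ->
  infinite_set K.
Proof.
apply: contra_not => finK.
have /finite_seqP[s sE] := finite_ball genS r finS.
pose Z (k : {ffun I -> 'I_(size s)}) := [set x | forall i, D i ->
  left_coset (g i) (P i) (x * nth 1%g s (k i))%g].
apply: (@sub_finite_set _ _ (\bigcup_k Z k)).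
  move=> x xZ; have /choice[k kP] : forall i, exists n : 'I_(size s),
      D i -> left_coset (g i) (P i) (x * nth 1%g s n)%g.
    move=> i; have [Di|nDi] := pselect (D i); last first.
      (* Outside [D] any index will do; one exists because the ball contains 1. *)
      have: 1%g \in s.
        suff: [set` s] 1%g by [].
        by rewrite -sE /= word_norm1.
      by rewrite -index_mem => lt1; exists (Ordinal lt1).
    have [a Aa xa] := xZ i Di.
    have: (x^-1 * a)%g \in s.
      suff: [set` s] (x^-1 * a)%g by [].
      by rewrite -sE /= word_norm_sym.
    move=> xas; have lts := xas; rewrite -index_mem in lts.
    by exists (Ordinal lts) => _ /=; rewrite nth_index // mulVKg.
  by exists [ffun i => k i] => // i Di; rewrite ffunE; apply: kP.
apply: bigcup_finite => [|k _]; first exact: finite_finset.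
have [[x0 Zx0]|Zk0] := pselect (exists x, Z k x); last first.
  apply: (@sub_finite_set _ _ set0) => // x Zx; apply: Zk0; by exists x.
apply: (@sub_finite_set _ _ [set (y * x0)%g | y in K]); last exact: finite_image.
move=> x Zx; exists (x / x0)%g; last by rewrite mulgVK.
move=> i Di; have [[p Pp px] [p0 Pp0 px0]] := (Zx i Di, Zx0 i Di).
exists (p / p0)%g.
  by have [_ PB] := gP i; apply/set_mem/PB; apply/mem_set.
(* With the common displacement [u], [x / x0 = (x * u) / (x0 * u)], which is
   [(g i * p) / (g i * p0)]. *)
by rewrite -(mulgKA (nth 1%g s (k i)) x x0) -px -px0 invgM !mulgA.
Qed.

End Cosets.

(** * Transfer of cosets and intersections along a coarse relation *)

Section Correspondence.

(* The relation [E x y] stands for [d(q x, y) <= c]. Working with a relation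
   makes the notion symmetric, so that no quasi-inverse has to be chosen. *)
Definition matched (G H : groupType) (E : G -> H -> Prop) (A : set G)
    (B : set H) : Prop :=
  (forall a, A a -> exists2 b, B b & E a b) /\
  (forall b, B b -> exists2 a, A a & E a b).

(** Only upper control is asked: lower control of [E] is the same clause for the transposed
    relation, whose totality is coarse surjectivity. *)
Definition coarse_map (G H : groupType) (E : G -> H -> Prop) (S : set G)
    (T : set H) (PP : set (set G)) (QQ : set (set H)) : Prop :=
  [/\ forall x, exists y, E x y,
      forall n, exists n', forall x x' y y', E x y -> E x' y' ->
        (word_norm S (x^-1 * x')%g <= n)%N -> (word_norm T (y^-1 * y')%g <= n')%N &
      forall A, left_cosets PP A -> exists2 B, left_cosets QQ B & matched E A B].

Variables (G H : groupType) (E : G -> H -> Prop) (S : set G) (T : set H).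
Variables (PP : set (set G)) (QQ : set (set H)).
Hypotheses (finS : finite_set S) (genS : generates S).
Hypotheses (finT : finite_set T) (genT : generates T).
Hypothesis finQQ : finite_set QQ.
Hypothesis gPP : forall P, PP P -> group_closed (mem P).
Hypothesis gQQ : forall Q, QQ Q -> group_closed (mem Q).
Hypotheses (coarseE : coarse_map E S T PP QQ)
  (coarseEV : coarse_map (fun y x => E x y) T S QQ PP).

Lemma matched_cosets_bounded : exists k, forall A m h Q (J : {set 'I_m}),
  left_cosets PP A -> distinct_cosets QQ h Q ->
  (forall j, j \in J -> matched E A (left_coset (h j) (Q j))) -> (#|J| <= k)%N.
Proof.
(* Control at distance 0 bounds the spread of the points related to a single point. *)
have [Etot /(_ 0%N)[n nP] _] := coarseE.
have /finite_seqP[s sE] := finite_ball genT n finT.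
have /finite_seqP[t tE] := finQQ.
(* Ball size times number of subgroups: a coset is determined by its subgroup and a point [y0 * u]
   on it. *)
exists (size s * size t)%N => A m h Q J [g [P PPP ->]] [QQQ hQinj] JP.
have [y0 Ey0] := Etot g.
have /choice[u uP] : forall j, exists u, j \in J -> u \in s /\
    left_coset (h j) (Q j) = left_coset (y0 * u)%g (Q j).
  move=> j; have [jJ|jNJ] := boolP (j \in J); last by exists 1%g.
  have [/(_ g (left_coset_refl _ (gPP PPP)))[y By Ey] _] := JP j jJ.
  exists (y0^-1 * y)%g => _; rewrite mulVKg; split; last first.
    exact: left_coset_eq (gQQ (QQQ j)) By.
  suff: [set` s] (y0^-1 * y)%g by [].
  by rewrite -sE /=; apply: nP Ey0 Ey _; rewrite mulVg word_norm1.
rewrite -(size_allpairs pair) cardE -(size_map (fun j => (u j, Q j))).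
apply: uniq_leq_size => [|_ /mapP[j jJ ->]].
  rewrite map_inj_in_uniq ?enum_uniq // => i j; rewrite !mem_enum => iJ jJ.
  case=> uij Qij; apply: hQinj => /=.
  by rewrite (uP i iJ).2 (uP j jJ).2 uij Qij.
move: jJ; rewrite mem_enum => jJ; rewrite allpairs_f //; first by case: (uP j jJ).
suff: [set` t] (Q j) by [].
by rewrite -tE; apply: QQQ.
Qed.

(* The family in G is a transversal [s] of the fibres of the matching. *)
Lemma distinct_cosets_pullback : exists k, forall m h Q,
  distinct_cosets QQ h Q -> exists m' (g : 'I_m' -> G) P (s : 'I_m' -> 'I_m),
  [/\ distinct_cosets PP g P, injective s, (m <= k * m')%N &
      forall j, matched E (left_coset (g j) (P j))
                          (left_coset (h (s j)) (Q (s j)))].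
Proof.
have [k kP] := matched_cosets_bounded; have [_ _ QP] := coarseEV.
exists k => m h Q dhQ; have [QQQ _] := dhQ.
have /choice[p pP] : forall i, exists p : G * set G, PP p.2 /\
    matched E (left_coset p.1 p.2) (left_coset (h i) (Q i)).
  move=> i; have [|_ [g [P PPP ->]] [m1 m2]] := QP (left_coset (h i) (Q i)).
    by exists (h i), (Q i).
  by exists (g, P).
pose f i := left_coset (p i).1 (p i).2.
(* The fibre contains [i], so the default is never taken and [rep i] depends on [f i] alone. *)
pose rep i := odflt i [pick j | f j == f i].
have frep i : f (rep i) = f i.
  by rewrite /rep; case: pickP => [j /eqP|] //=.
have rep_eq i j : f i = f j -> rep i = rep j.
  move=> fij; rewrite /rep fij; case: pickP => // /(_ j).
  by rewrite eqxx.
pose J := (rep @: [set: 'I_m])%SET.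
exists #|J|, (fun j => (p (enum_val j)).1), (fun j => (p (enum_val j)).2).
exists enum_val; split.
- split=> [j|i j eqf]; first by have [] := pP (enum_val j).
  have /imsetP[i' _ iE] := enum_valP i; have /imsetP[j' _ jE] := enum_valP j.
  apply: enum_val_inj; rewrite iE jE; apply: rep_eq.
  by rewrite -frep -[RHS]frep -iE -jE.
- exact: enum_val_inj.
(* Count the [m] indices fibre by fibre; the cosets in one fibre are matched with the same [f i], so
   there are at most [k]. *)
- rewrite -{1}[m]card_ord -cardsT -sum1_card (partition_big_imset rep) /=.
  rewrite mulnC -sum_nat_const; apply: leq_sum => a /imsetP[i _ ->].
  rewrite sum1dep_card; apply: (kP (f i) _ h Q) => //.
    by exists (p i).1, (p i).2 => //; have [] := pP i.
  move=> j; rewrite !inE => /eqP /(congr1 f); rewrite !frep => <-.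
  by have [] := pP j.
- by move=> j; have [] := pP (enum_val j).
Qed.

(** Each common point in [H] is related to a common point in [G], at the cost of a larger radius. A
    point of [G] is related only to points of one finite ball, so finiteness in [G] would force it
    in [H]. *)
Lemma infinite_thickening_pullback (I : Type) (D : set I) (A : I -> set G)
    (B : I -> set H) r :
  (forall i, D i -> matched E (A i) (B i)) ->
  infinite_set (\bigcap_(i in D) thickening T (B i) r) ->
  exists r', infinite_set (\bigcap_(i in D) thickening S (A i) r').
Proof.
move=> AB infB; have [Etot ctlE _] := coarseE; have [EtotV ctlEV _] := coarseEV.
have [r' r'P] := ctlEV r; exists r'; move: infB; apply: contra_not => finA.
apply: (@sub_finite_set _ _ (\bigcup_(x in
   \bigcap_(i in D) thickening S (A i) r') [set y | E x y])).
  move=> y yB; have [x Exy] := EtotV y; exists x => // i Di.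
  have [b Bb by_] := yB i Di; have [a Aa Eab] := (AB i Di).2 b Bb.
  by exists a => //; apply: r'P Eab Exy by_.
apply: bigcup_finite => // x _; have [y0 Ey0] := Etot x.
have [n nP] := ctlE 0%N.
apply: (@sub_finite_set _ _ [set (y0 * u)%g | u in
   [set u | (word_norm T u <= n)%N]]); last first.
  exact/finite_image/finite_ball.
move=> y Exy; exists (y0^-1 * y)%g; last by rewrite mulVKg.
by apply: nP Ey0 Exy _; rewrite mulVg word_norm1.
Qed.

Lemma infinite_conj_pullback (I : finType) (D : set I) g P h Q :
  (forall i, PP (P i)) ->
  (forall i, matched E (left_coset (g i) (P i)) (left_coset (h i) (Q i))) ->
  infinite_set (\bigcap_(i in D) conj_subgroup (h i) (Q i)) ->
  infinite_set (\bigcap_(i in D) conj_subgroup (g i) (P i)).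
Proof.
move=> PPP PQ infQ; have [r rP] := conj_sub_thickening h Q D genT.
have infT : infinite_set
    (\bigcap_(i in D) thickening T (left_coset (h i) (Q i)) r).
  by apply: contra_not infQ; apply: sub_finite_set rP.
have [r' infS] := infinite_thickening_pullback (fun i _ => PQ i) infT.
by apply: infinite_thickening_conj infS => // i; apply: gPP.
Qed.

Lemma finite_height_pushforward : finite_height PP -> finite_height QQ.
Proof.
have [k kP] := distinct_cosets_pullback; case=> N NP; exists (k * N)%N.
move=> m h Q dhQ infQ; have [m' [g [P [s [dgP _ mm' gh]]]]] := kP m h Q dhQ.
apply: leq_trans mm' _; rewrite leq_mul2l; apply/orP; right.
apply: (NP _ _ _ dgP); apply: infinite_conj_pullback gh _.
  by case: dgP.
(* Intersecting only over the transversal enlarges the intersection. *)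
by apply: contra_not infQ; apply: sub_finite_set => x xQ j _; apply: xQ.
Qed.

Lemma finite_width_pushforward : finite_width PP -> finite_width QQ.
Proof.
have [k kP] := distinct_cosets_pullback; case=> N NP; exists (k * N)%N.
move=> m h Q dhQ infQ.
have [m' [g [P [s [dgP s_inj mm' gh]]]]] := kP m h Q dhQ.
apply: leq_trans mm' _; rewrite leq_mul2l; apply/orP; right.
apply: (NP _ _ _ dgP) => i j ij.
have := @infinite_conj_pullback _ [set i; j] g P (h \o s) (Q \o s).
rewrite !bigcap_setU1 !bigcap_set1 /=; apply=> //; first by case: dgP.
(* The transversal [s] need not preserve the order in which [infQ] is stated. *)
have [lt_s|lt_s|/val_inj/s_inj eq_ij] := ltngtP (s i) (s j).
- exact: infQ.
- by rewrite setIC; apply: infQ.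
- by rewrite eq_ij ltnn in ij.
Qed.

End Correspondence.

(** * From quasi-isometries of pairs to coarse relations *)

Local Open Scope ring_scope.

(** The infimum need not be attained, but strictness yields an admissible radius below [M]. *)
Lemma hdist_lt (R : realType) (X : Type) (d : X -> X -> R) (A B : set X) M :
  (hdist d A B < M%:E)%E ->
  (forall a, A a -> exists2 b, B b & d a b <= M) /\
  (forall b, B b -> exists2 a, A a & d a b <= M).
Proof.
case/ereal_inf_lt => _ [r [_ AB BA] <-]; rewrite lte_fin => /ltW rM.
by split=> [a /AB[b Bb ab]|b /BA[a Aa ab]]; [exists b|exists a];
  rewrite ?(le_trans ab).
Qed.

Lemma quasi_isometric_coarse_map (R : realType) (G H : groupType) (S : set G)
    (T : set H) (PP : set (set G)) (QQ : set (set H)) :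
  generates T -> quasi_isometric_pairs R S T PP QQ ->
  exists E, coarse_map E S T PP QQ /\ coarse_map (fun y x => E x y) T S QQ PP.
Proof.
move=> genT [q [M [[L [C [L1 C0 qi qsurj]]] M0 PQ QP]]].
have Mge0 := ltW M0.
(* A natural number dominating both [C], for coarse surjectivity, and [M], for matching cosets. *)
pose c := Num.bound (C + M).
have [Cc Mc] : C <= c%:R /\ M <= c%:R.
  have CMc : C + M <= c%:R by apply/ltW/archi_boundP/addr_ge0.
  by split; apply: le_trans CMc; rewrite ?lerDl ?lerDr.
pose E x y := (word_norm T ((q x)^-1 * y)%g <= c)%N.
have L0 : 0 < L by apply: lt_le_trans L1.
have near_q x y r : r <= c%:R -> word_dist R T (q x) y <= r -> E x y.
  by move=> rc /le_trans/(_ rc); rewrite ler_nat.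
have matchE A B : (hdist (word_dist R T) (q @` A) B < M%:E)%E -> matched E A B.
  case/hdist_lt => AB BA; split=> [a Aa|b /BA[_ [a Aa <-] ab]].
    have [|b Bb ab] := AB (q a); first by exists a.
    by exists b => //; apply: near_q ab.
  by exists a => //; apply: near_q ab.
exists E; split; split.
- by move=> x; exists (q x); rewrite /E mulVg word_norm1.
(* The three legs of the path [y], [q x], [q x'], [y']. *)
- move=> n; exists (c + (Num.bound (L * n%:R + C) + c))%N => x x' y y' xy xy' xx'.
  apply: leq_trans (word_norm_triangle genT (q x) _ _) _.
  rewrite leq_add //; first by rewrite word_norm_sym.
  apply: leq_trans (word_norm_triangle genT (q x') _ _) _.
  rewrite leq_add //; have /andP[_ qxx'] := qi x x'.
  rewrite -(ler_nat R); apply: le_trans qxx' _.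
  apply/ltW/(le_lt_trans _)/(archi_boundP _); last first.
    by rewrite addr_ge0 // mulr_ge0 // ltW.
  by rewrite lerD2r ler_pM2l // ler_nat.
- by move=> A /PQ[B QB /matchE AB]; exists B.
- by move=> y; have [x yx] := qsurj y; exists x;
    apply: near_q Cc _; rewrite /word_dist word_norm_sym.
(* The path [q x], [y], [y'], [q x'] has length at most [c + (n + c)]; solve the lower
   quasi-isometry bound for the distance from [x] to [x']. *)
- move=> n; exists (Num.bound (L * ((c + (n + c))%:R + C))) => y y' x x' xy xy' yy'.
  have /andP[qxx' _] := qi x x'.
  rewrite -(ler_nat R); apply/ltW/(le_lt_trans _)/(archi_boundP _); last first.
    by rewrite mulr_ge0 ?addr_ge0 // ltW.
  rewrite -ler_pdivrMl // -lerBlDr; apply: le_trans qxx' _; rewrite ler_nat.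
  apply: leq_trans (word_norm_triangle genT y _ _) _; rewrite leq_add //.
  apply: leq_trans (word_norm_triangle genT y' _ _) _; rewrite leq_add //.
  by rewrite word_norm_sym.
- by move=> B /QP[A PA /matchE[AB BA]]; exists A.
Qed.

Theorem theorem5p3 (R : realType) (G H : groupType) (S : set G) (T : set H)
    (PP : set (set G)) (QQ : set (set H)) :
  finite_generating_set S -> finite_generating_set T ->
  group_pair PP -> group_pair QQ ->
  quasi_isometric_pairs R S T PP QQ ->
  (finite_width PP <-> finite_width QQ) /\
  (finite_height PP <-> finite_height QQ).
Proof.
move=> [finS genS] [finT genT] [_ finPP PPg] [_ finQQ QQg].
case/(quasi_isometric_coarse_map genT) => E [EGH EHG].
have gPP P : PP P -> group_closed (mem P) by case/PPg.
have gQQ Q : QQ Q -> group_closed (mem Q) by case/QQg.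
(* Converses are the same pushforwards for the transposed relation. *)
split; split.
- exact: (finite_width_pushforward finS genS finT genT finQQ gPP gQQ EGH EHG).
- exact: (finite_width_pushforward finT genT finS genS finPP gQQ gPP EHG EGH).
- exact: (finite_height_pushforward finS genS finT genT finQQ gPP gQQ EGH EHG).
- exact: (finite_height_pushforward finT genT finS genS finPP gQQ gPP EHG EGH).
Qed.
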